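(* Let $f^*$ be the optimal value of $$(P):\quad \min_{x\in X} f(x)\quad\text{s.t. } g(x,u)\ge0\ \ \forall u\in U,$$ and let $\tilde f^*$ be the optimal value of $$(\widetilde P):\quad \min_{x\in X} f(x)\quad\text{s.t. } \tilde g(x,\tilde u)\ge0\ \ \forall \tilde u\in\widetilde U.$$ Then $\tilde f^*\ge f^*$, and equality holds if $U$ is closed at $\infty$.
   Context: $X=\{x\in\mathbb{R}^n\mid\theta_1(x)\ge0,\dots,\theta_{m_2}(x)\ge0\}$ is assumed compact; $f,\theta_i\in\mathbb{R}[x]$, $g\in\mathbb{R}[x,u]$, $h_j\in\mathbb{R}[u]$ are real polynomials, $x\in\mathbb{R}^n$, $u\in\mathbb{R}^p$. $U$ is assumed to be infinite (not necessarily compact). The optimal value of an infeasible problem is $+\infty$. For $q\in\mathbb{R}[u]$ of degree $d$, $\tilde q(\tilde u)=u_0^d q(u/u_0)$ is its homogenization, $\tilde u=(u_0,u)\in\mathbb{R}^{p+1}$. Also $\tilde g(x,\tilde u)=u_0^{d_g}g(x,u/u_0)$ with $d_g=\deg_u g(x,u)$, the degree of $g$ in $u$. The sets are $U=\{u\in\mathbb{R}^p\mid h_1(u)\ge0,\dots,h_{m_1}(u)\ge0\}$, $U_0=\{\tilde u\in\mathbb{R}^{p+1}\mid \tilde h_1(\tilde u)\ge0,\dots,\tilde h_{m_1}(\tilde u)\ge0,\ u_0>0,\ \|\tilde u\|^2=1\}$, $\widetilde U=\{\tilde u\in\mathbb{R}^{p+1}\mid \tilde h_1(\tilde u)\ge0,\dots,\tilde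 h_{m_1}(\tilde u)\ge0,\ u_0\ge0,\ \|\tilde u\|^2=1\}$. $U$ (with its description by $h_1,\dots,h_{m_1}$) is called closed at $\infty$ if the Euclidean closure of $U_0$ equals $\widetilde U$. *)

(* Defs.v *)
From HB Require Import structures.
From mathcomp Require Import all_boot all_order all_algebra.
From mathcomp Require Import all_classical all_reals all_analysis.
(* The notations of mpoly clash with those of mathcomp-analysis. *)
From mathcomp Require Import -(notations) mpoly.
Set Implicit Arguments.
Unset Strict Implicit.
Unset Printing Implicit Defensive.
Import Order.TTheory GRing.Theory Num.Theory.
Import numFieldNormedType.Exports.
Local Open Scope classical_set_scope.
Local Open Scope ring_scope.

Notation "{ 'mpoly' T [ n ] }" := (mpoly n T) : type_scope.

Definition peval (R : realType) (n : nat) (q : {mpoly R[n]}) (x : 'rV[R]_n) : R :=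
  meval (fun i => x 0 i) q.

Definition total_degree (R : realType) (p : nat) (q : {mpoly R[p]}) : nat :=
  (\max_(m <- msupp q) mdeg m)%N.

(* Indeterminates of the homogenization: 'X_0 is u_0 and 'X_(j+1) is u_j. *)
Definition homog_monom (p d : nat) (m : multinom p) : multinom p.+1 :=
  Multinom [tuple if unlift ord0 i is Some j then m j else (d - mdeg m)%N
           | i < p.+1].

(* Defined on coefficients, since u_0 ^ d * q (u / u_0) makes no sense at
   u_0 = 0; see homogenizeE for the agreement when u_0 != 0. *)
Definition homogenize (R : realType) (p : nat) (q : {mpoly R[p]}) :
    {mpoly R[p.+1]} :=
  \sum_(m <- msupp q) mcoeff m q *: mpolyX R (homog_monom (total_degree q) m).

(* Elements of R[x, u] are polynomials in n + p indeterminates, the last p of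
   which are the u_j. *)
Definition mdeg_u (n p : nat) (m : multinom (n + p)) : nat :=
  (\sum_(j < p) m (rshift n j))%N.

Definition degree_u (R : realType) (n p : nat) (g : {mpoly R[n + p]}) : nat :=
  (\max_(m <- msupp g) mdeg_u m)%N.

Definition homog_monom_u (n p d : nat) (m : multinom (n + p)) :
    multinom (n + p.+1) :=
  Multinom [tuple match fintype.split i with
                  | inl k => m (lshift p k)
                  | inr k => if unlift ord0 k is Some j then m (rshift n j)
                             else (d - mdeg_u m)%N
                  end | i < n + p.+1].

Definition homogenize_u (R : realType) (n p : nat) (g : {mpoly R[n + p]}) :
    {mpoly R[n + p.+1]} :=
  \sum_(m <- msupp g) mcoeff m g *: mpolyX R (homog_monom_u (degree_u g) m).

Definition dehomog (R : realType) (p : nat) (v : 'rV[R]_p.+1) : 'rV[R]_p :=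
  \row_j (v 0 (lift ord0 j) / v 0 ord0).

Lemma homogenizeE (R : realType) (p : nat) (q : {mpoly R[p]})
    (v : 'rV[R]_p.+1) : v 0 ord0 != 0 ->
  peval (homogenize q) v
  = v 0 ord0 ^+ total_degree q * peval q (dehomog v).
Proof.
move=> v0; rewrite /peval /homogenize raddf_sum /=.
rewrite [in RHS]mevalE big_distrr /=; apply: eq_big_seq => m mq.
rewrite mevalZ mevalX big_ord_recl /fun_of_multinom !tnth_mktuple unlift_none.
have mle : (mdeg m <= total_degree q)%N by apply: leq_bigmax_seq.
rewrite [RHS]mulrCA; congr (_ * _).
rewrite -[in RHS](subnK mle) exprD -mulrA; congr (_ * _).
rewrite mdegE -prodrXr -big_split /=; apply: eq_bigr => i _.
by rewrite !tnth_mktuple liftK mxE -exprMn [_ * (_ / _)]mulrC divfK.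
Qed.

Lemma homogenize_uE (R : realType) (n p : nat) (g : {mpoly R[n + p]})
    (x : 'rV[R]_n) (v : 'rV[R]_p.+1) : v 0 ord0 != 0 ->
  peval (homogenize_u g) (row_mx x v)
  = v 0 ord0 ^+ degree_u g * peval g (row_mx x (dehomog v)).
Proof.
move=> v0; rewrite /peval /homogenize_u raddf_sum /=.
rewrite [in RHS]mevalE big_distrr /=; apply: eq_big_seq => m mg.
have mle : (mdeg_u m <= degree_u g)%N by apply: leq_bigmax_seq.
rewrite mevalZ mevalX [RHS]mulrCA; congr (_ * _).
rewrite !big_split_ord /= [RHS]mulrCA; congr (_ * _).
  apply: eq_bigr => i _.
  by rewrite !row_mxEl [X in _ ^+ X]tnth_mktuple -/(unsplit (inl i)) unsplitK.
rewrite big_ord_recl [X in _ ^+ X * _]tnth_mktuple.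
rewrite -/(unsplit (inr ord0)) unsplitK unlift_none row_mxEr.
rewrite -[in RHS](subnK mle) exprD -mulrA; congr (_ * _).
rewrite /mdeg_u -prodrXr -big_split /=; apply: eq_bigr => i _.
rewrite [X in _ ^+ X]tnth_mktuple -/(unsplit (inr (lift ord0 i))) unsplitK.
by rewrite liftK !row_mxEr mxE -exprMn [_ * (_ / _)]mulrC divfK.
Qed.

Definition nonneg_set (R : realType) (k m : nat) (q : 'I_m -> {mpoly R[k]}) :
    set 'rV[R]_k :=
  [set x | forall i, 0 <= peval (q i) x].

(* U_0; the norm is Euclidean (the library norm on row vectors is the sup
   norm). *)
Definition homog_set0 (R : realType) (p m : nat) (h : 'I_m -> {mpoly R[p]}) :
    set 'rV[R]_p.+1 :=
  [set v | [/\ forall i, 0 <= peval (homogenize (h i)) v,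
               0 < v 0 ord0 & \sum_i v 0 i ^+ 2 = 1]].

(* U tilde *)
Definition homog_set (R : realType) (p m : nat) (h : 'I_m -> {mpoly R[p]}) :
    set 'rV[R]_p.+1 :=
  [set v | [/\ forall i, 0 <= peval (homogenize (h i)) v,
               0 <= v 0 ord0 & \sum_i v 0 i ^+ 2 = 1]].

Definition closed_at_infinity (R : realType) (p m : nat)
    (h : 'I_m -> {mpoly R[p]}) : Prop :=
  closure (homog_set0 h) = homog_set h.

Definition feasible (R : realType) (n k : nat) (X : set 'rV[R]_n)
    (g : {mpoly R[n + k]}) (V : set 'rV[R]_k) : set 'rV[R]_n :=
  [set x | X x /\ forall u, V u -> 0 <= peval g (row_mx x u)].

(* +oo when the problem is infeasible, as ereal_inf set0 = +oo *)
Definition optimal_value (R : realType) (n k : nat) (X : set 'rV[R]_n)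
    (f : {mpoly R[n]}) (g : {mpoly R[n + k]}) (V : set 'rV[R]_k) : \bar R :=
  ereal_inf [set (peval f x)%:E | x in feasible X g V].

(* Main.v *)
Require Import Defs.
From HB Require Import structures.
From mathcomp Require Import all_boot all_order all_algebra.
From mathcomp Require Import all_classical all_reals all_analysis.
From mathcomp Require Import -(notations) mpoly.
Set Implicit Arguments.
Unset Strict Implicit.
Unset Printing Implicit Defensive.
Import Order.TTheory GRing.Theory Num.Theory.
Import numFieldNormedType.Exports.
Local Open Scope classical_set_scope.
Local Open Scope ring_scope.

(** Both problems minimize the same f over subsets of X, so everything is a
    comparison of feasible sets.  The problem that bridges them has the
    homogenized constraint imposed on U_0, the part of U tilde where u_0 > 0.

    Scaling by u_0 identifies U_0 with U: the points of U_0 are exactly the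
    (1, u) / ||(1, u)|| with u in U, and on them the homogenization of a
    polynomial differs from the value of the polynomial at u by a positive
    factor, a power of u_0.  Hence the constraint g >= 0 on U and its
    homogenized form on U_0 cut out the same points x
    ([feasible_homog_set0]).

    As U_0 is contained in U tilde, the homogenized problem is the more
    constrained one, and its infimum is at least f*.  The only constraints it
    adds are those at infinity, where u_0 = 0.  For fixed x the constraint is a
    weak polynomial inequality in u tilde, so by continuity it extends from
    U_0 to the closure of U_0 ([feasible_closure]); when U is closed at
    infinity this closure is U tilde, and the two feasible sets coincide. *)

Lemma continuous_peval (R : realType) (n : nat) (T : topologicalType)
    (q : {mpoly R[n]}) (v : T -> 'rV[R]_n) :
  (forall i, continuous (fun t => v t 0 i)) ->
  continuous (fun t => peval q (v t)).
Proof.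
move=> v_cont t; rewrite /peval.
have -> : (fun s => meval (fun i => v s 0 i) q) =
    (fun s => \sum_(m <- msupp q) mcoeff m q * \prod_i v s 0 i ^+ m i).
  by apply/funext => s; rewrite mevalE.
apply: (@continuous_big _ _ +%R) => [|m _ {}t]; first exact: add_continuous.
apply: continuousM; first exact: cst_continuous.
suff: continuous (fun s => \prod_i v s 0 i ^+ m i) by exact.
apply: (@continuous_big R _ *%R 1 predT _ T _ (fun i s => v s 0 i ^+ m i)).
  exact: mul_continuous.
move=> i _ s.
apply: (continuous_comp (f := fun r => v r 0 i) (g := fun y => y ^+ m i)).
  exact: v_cont.
exact: exprn_continuous.
Qed.

Lemma continuous_row_mx (R : realType) (n p : nat) (x : 'rV[R]_n)
    (i : 'I_(n + p)) : continuous (fun v : 'rV[R]_p => row_mx x v 0 i).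
Proof.
case: (split_ordP i) => j ->.
  under eq_fun do rewrite row_mxEl.
  exact: cst_continuous.
under eq_fun do rewrite row_mxEr.
exact: coord_continuous.
Qed.

(** The inverse of the dehomogenization, u |-> (1, u) / ||(1, u)||: it shows
    that no constraint is lost by restricting to the open upper half of the
    unit sphere. *)
Lemma sphere_lift (R : realType) (p : nat) (u : 'rV[R]_p) :
  exists v : 'rV[R]_p.+1,
    [/\ 0 < v 0 ord0, \sum_i v 0 i ^+ 2 = 1 & dehomog v = u].
Proof.
(* s is the squared Euclidean norm of (1, u). *)
pose s := 1 + \sum_i u 0 i ^+ 2.
have s_gt0 : 0 < s.
  by rewrite ltr_pwDl // sumr_ge0 // => i _; exact: sqr_ge0.
have sqrt_gt0 : 0 < Num.sqrt s by rewrite sqrtr_gt0.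
exists (\row_i (oapp (u 0) 1 (unlift ord0 i) / Num.sqrt s)).
split; first by rewrite mxE unlift_none mul1r invr_gt0.
- rewrite big_ord_recl mxE unlift_none mul1r.
  under eq_bigr do rewrite mxE liftK exprMn.
  rewrite -mulr_suml -[X in X + _]mul1r -mulrDl exprVn sqr_sqrtr ?ltW //.
  by rewrite divff // gt_eqF.
- apply/rowP => j; rewrite !mxE liftK unlift_none mul1r /=.
  by rewrite mulfK // gt_eqF // invr_gt0.
Qed.

(** Where u_0 > 0, the homogenization of h_i has the sign of h_i at u / u_0. *)
Lemma homog_set0_dehomog (R : realType) (p m : nat) (h : 'I_m -> {mpoly R[p]})
    (v : 'rV[R]_p.+1) :
  homog_set0 h v <->
  [/\ nonneg_set h (dehomog v), 0 < v 0 ord0 & \sum_i v 0 i ^+ 2 = 1].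
Proof.
have sgn i : 0 < v 0 ord0 ->
    (0 <= peval (homogenize (h i)) v) = (0 <= peval (h i) (dehomog v)).
  by move=> v0; rewrite homogenizeE ?gt_eqF // pmulr_rge0 // exprn_gt0.
by split=> -[hv v0 v1]; split=> // i; move: (hv i); rewrite sgn.
Qed.

(** U_0 is a rescaled copy of U, and rescaling does not change the sign of the
    constraint function. *)
Lemma feasible_homog_set0 (R : realType) (n p m : nat) (X : set 'rV[R]_n)
    (g : {mpoly R[n + p]}) (h : 'I_m -> {mpoly R[p]}) :
  feasible X (homogenize_u g) (homog_set0 h) = feasible X g (nonneg_set h).
Proof.
have sgn x (v : 'rV[R]_p.+1) : 0 < v 0 ord0 ->
    (0 <= peval (homogenize_u g) (row_mx x v)) =
    (0 <= peval g (row_mx x (dehomog v))).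
  by move=> v0; rewrite homogenize_uE ?gt_eqF // pmulr_rge0 // exprn_gt0.
apply/seteqP; split=> x [Xx gx]; split=> // u.
  have [v [v0 v1 <-]] := sphere_lift u => Uv.
  by rewrite -sgn //; apply: gx; apply/homog_set0_dehomog.
by move=> /homog_set0_dehomog[Uv v0 _]; rewrite sgn //; exact: gx.
Qed.

Lemma feasible_subset (R : realType) (n k : nat) (X : set 'rV[R]_n)
    (g : {mpoly R[n + k]}) (V W : set 'rV[R]_k) :
  V `<=` W -> feasible X g W `<=` feasible X g V.
Proof. by move=> VW x [Xx gx]; split=> // u /VW; exact: gx. Qed.

(** For fixed x, the set of v with 0 <= g(x, v) is closed, so it contains the
    closure of V as soon as it contains V. *)
Lemma feasible_closure (R : realType) (n k : nat) (X : set 'rV[R]_n)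
    (g : {mpoly R[n + k]}) (V : set 'rV[R]_k) :
  feasible X g (closure V) = feasible X g V.
Proof.
apply/seteqP; split; first exact/feasible_subset/subset_closure.
move=> x [Xx gx]; split=> // u Vu.
have /closure_id S_closed : closed [set v | 0 <= peval g (row_mx x v)].
  apply: (@preimage_closed _ R _ [set y | 0 <= y]); last exact: closed_ge.
  by move=> v _; apply: continuous_peval; exact: continuous_row_mx.
by have := closureS gx Vu; rewrite -S_closed.
Qed.

Theorem theorem4p6 (R : realType) (n p m1 m2 : nat)
    (f : {mpoly R[n]}) (g : {mpoly R[n + p]})
    (theta : 'I_m2 -> {mpoly R[n]}) (h : 'I_m1 -> {mpoly R[p]})
    (X_compact : compact (nonneg_set theta))
    (U_infinite : infinite_set (nonneg_set h)) :
  let fstar := optimal_value (nonneg_set theta) f g (nonneg_set h) in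
  let ftilde :=
    optimal_value (nonneg_set theta) f (homogenize_u g) (homog_set h) in
  (fstar <= ftilde)%E /\ (closed_at_infinity h -> ftilde = fstar).
Proof.
rewrite /optimal_value /=; split.
  rewrite -feasible_homog_set0; apply/ereal_inf_le_tmp/image_subset.
  by apply: feasible_subset => v [hv /ltW v0 v1].
by move=> <-; rewrite feasible_closure feasible_homog_set0.
Qed.
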